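(* Let $\mathbb{F}$ be any field and $d\ge 2$. Let $\mathcal L_1,\dots,\mathcal L_d$ be finite sets of lines in $\mathbb{F}^d$, and let $\mathcal J$ be a set of points each of which is the intersection of exactly one line from each $\mathcal L_i$ ($i=1,\dots,d$), these $d$ lines not all lying in a common hyperplane. Then \[ |\mathcal J|\le \bigl(d!\,|\mathcal L_1|\cdots|\mathcal L_d|\bigr)^{1/(d-1)}. \] *)

(* Defs.v *)
From mathcomp Require Import all_boot all_order all_algebra.
From mathcomp Require Import finmap.
From mathcomp Require Import boolp classical_sets cardinality reals exp.

Set Implicit Arguments.
Unset Strict Implicit.
Unset Printing Implicit Defensive.

Import GRing.Theory.

Local Open Scope classical_set_scope.
Local Open Scope ring_scope.

Definition is_flat (F : fieldType) (d k : nat) (A : set 'rV[F]_d) : Prop :=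
  exists (a : 'rV[F]_d) (U : {vspace 'rV[F]_d}),
    \dim U = k /\ A = [set a + u | u in [set` U]].

Definition is_line (F : fieldType) (d : nat) (A : set 'rV[F]_d) : Prop :=
  is_flat 1 A.

(* Affine hyperplanes: they need not pass through the origin. *)
Definition is_hyperplane (F : fieldType) (d : nat) (A : set 'rV[F]_d) : Prop :=
  is_flat d.-1 A.

(* The selection l takes exactly one line from each L i.  Other members of
   L i are allowed to pass through p as well. *)
Definition is_multijoint (F : fieldType) (d : nat)
    (L : 'I_d -> {fset set 'rV[F]_d}) (p : 'rV[F]_d) : Prop :=
  exists l : 'I_d -> set 'rV[F]_d,
    [/\ forall i, l i \in L i,
        \bigcap_i l i = [set p]
      & ~ exists H : set 'rV[F]_d, is_hyperplane H /\ forall i, l i `<=` H].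

(* Main.v *)
(** This is the handicap method of Yu and Zhao, run with integers.  Choose for
every multijoint [p] one tuple of lines [l_1(p), ..., l_d(p)], and write [b_i(p)]
for a number of vanishing conditions attached to [p] on [l_i(p)].  If, for some
handicaps [beta(p)], the truncated numbers [b_i(p) + beta(p) - beta(q)], summed
over the [q] with [l_i(q) = l_i(p)], always exceed [n], then a polynomial of
degree at most [n] whose expansion at each [p], in coordinates along the lines,
has no monomial with all exponents below [b_i(p)] is zero.  Counting dimensions,
[C(d + n, d) <= \sum_p \prod_i b_i(p)].

To make the right-hand side small, let [b] minimise the energy
[M \sum_p c(p)^2 + \sum_(p, i) m_i b_i(p)^2], where [m_i = \prod_(j <> i) |L_j|]
and [c(p) = \sum_i m_i b_i(p)], among the [b] summing to [M^2] on every line.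
Moving one unit along a line shows that, up to a bounded error, [b] comes from the
handicaps [beta = M c].  On the set [S] of points where [c] is nearly minimal, cut
at a gap in the values of [c], the lines meeting [S] carry all their mass inside
[S], and there [c(p)] is at most about [d M^2 \prod_i |L_i| / |J|].  The
arithmetic-geometric mean inequality then bounds each product [\prod_i b_i(p)],
and [M -> oo] gives the constant. *)

Require Import Defs.
From mathcomp Require Import all_boot all_order all_algebra.
From mathcomp Require Import zify boolp.
From mathcomp Require mpoly.

Set Implicit Arguments.
Unset Strict Implicit.
Unset Printing Implicit Defensive.

Import Order.TTheory GRing.Theory Num.Theory.

(** * Optimal distribution of vanishing conditions *)

Section Combinatorics.
Local Open Scope nat_scope.

(** * Integer inequalities, gaps and energy minimisation *)

Lemma leq_AGM (d : nat) (a : 'I_d -> nat) :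
  d ^ d * \prod_i a i <= (\sum_i a i) ^ d.
Proof.
have [|+ _] := @leif_AGM_scaled int 'I_d predT (fun i => (a i)%:R%R).
  by move=> i _; rewrite -mulrnA ler0n.
rewrite (eq_bigr (fun i => ((d * a i)%:R)%R)); last first.
  by move=> i _; rewrite -mulrnA mulnC card_ord.
rewrite -natr_prod -natr_sum -natrX ler_nat.
by rewrite big_split /= prod_nat_const card_ord.
Qed.

Lemma expn_leq_ffact (d n : nat) : n.+1 ^ d <= (d + n) ^_ d.
Proof.
elim: d => [|d IH]; first by rewrite ffactn0 expn0.
by rewrite addSn ffactSS expnS leq_mul // ltnS leq_addl.
Qed.

(** Beyond its top term, [(a * M + C) ^ d] is of order [M ^ (d - 1)]; the extra factor [M] keeps
    this within the naturals. *)
Lemma expn_affine_le (a C d : nat) : exists C', forall M, 0 < M ->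
  (a * M + C) ^ d * M <= (a ^ d * M + C') * M ^ d.
Proof.
elim: d => [|d [C' IH]]; first by exists 0 => M _; rewrite !expn0; lia.
exists (a * C' + C * a ^ d + C * C') => M M0; rewrite !expnS.
have := leq_mul (leqnn (a * M + C)) (IH M M0); rewrite mulnA => h.
apply: leq_trans h _; rewrite mulnA [X in _ <= X]mulnA leq_mul2r; apply/orP; right.
move: (a ^ d) => x; nia.
Qed.

Lemma leading_coef_le (A B a C d : nat) :
  (forall M, 0 < M -> A * M ^ d <= B * (a * M + C) ^ d) -> A <= B * a ^ d.
Proof.
have [C' hC'] := expn_affine_le a C d.
move=> h; rewrite leqNgt; apply/negP => lt.
(* Cancelling [M ^ d] leaves [A * M <= B * a ^ d * M + B * C'], which fails for [A > B * a ^ d] once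
   [M > B * C']. *)
have M0 : 0 < (B * C').+1 by [].
have {h} := leq_mul (h _ M0) (leqnn (B * C').+1).
set M := (B * C').+1 in M0 *; rewrite -!mulnA.
have := leq_mul (leqnn B) (hC' _ M0).
move=> h1 h2; have := leq_trans h2 h1.
have : 0 < M ^ d by rewrite expn_gt0.
rewrite [X in A * X]mulnC !mulnA leq_mul2r => /lt0n_neq0/negPf-> /=.
rewrite mulnDr /M; move: (a ^ d) lt => x; nia.
Qed.

(** The sublevel sets at heights [c pm + k * g] increase with [k], and [#|T|] strict increases would
    outgrow [T]. Two equal consecutive sets give the gap. *)
Lemma exists_gap (T : finType) (c : T -> nat) (g : nat) : 0 < #|T| ->
  exists S : {set T}, [/\ S != set0,
    forall p q, p \in S -> c p <= c q + #|T| * g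
    & forall p q, p \in S -> q \notin S -> c p + g < c q].
Proof.
case/card_gt0P => p0 _; have [pm _ pmin] := arg_minnP c (erefl true : xpredT p0).
pose S k := [set p | c p <= c pm + k * g].
have [[k kT Sk]|nk] := pselect (exists2 k, k < #|T| & S k = S k.+1).
  exists (S k); split.
  - by apply/set0Pn; exists pm; rewrite inE leq_addr.
  - move=> p q; rewrite inE => /leq_trans; apply.
    by apply: leq_add; [exact: pmin|rewrite leq_mul2r ltnW ?orbT].
  move=> p q; rewrite inE {1}Sk inE -ltnNge mulSn; lia.
have cardS k : k <= #|T| -> k < #|S k|.
  elim: k => [_|k IH kT].
    by apply/card_gt0P; exists pm; rewrite inE leq_addr.
  apply: leq_ltn_trans (IH (ltnW kT)) _; apply: proper_card.
  rewrite properEneq; apply/andP; split; first by apply/eqP => e; apply: nk; exists k.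
  by apply/subsetP => p; rewrite !inE mulSn; lia.
by have := cardS _ (leqnn _); rewrite ltnNge max_card.
Qed.

(** On expansion the terms [M * m ^ 2] and [m] cancel; dividing by [2 * m] compares
    [a.-1 + M * (m * a.-1 + X)] with [b + M * (m * b + Y)]. Restoring the removed unit costs
    [M * m + 1]. *)
Lemma energy_transfer (M m a b X Y : nat) : 0 < m -> 0 < a ->
  M * (m * a + X) ^ 2 + m * a ^ 2 + (M * (m * b + Y) ^ 2 + m * b ^ 2) <=
  M * (m * a.-1 + X) ^ 2 + m * a.-1 ^ 2 +
    (M * (m * b.+1 + Y) ^ 2 + m * b.+1 ^ 2) ->
  a + M * (m * a + X) <= b + M * (m * b + Y) + (M * m + 1).
Proof.
case: a => //= a m0 _.
have sqS x : x.+1 ^ 2 = x * x + 2 * x + 1 by rewrite -mulnn; lia.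
rewrite !sqS !mulnS -!addnA.
move: (m * a + X) (m * b + Y) => C D h.
have : m * (M * C + a) <= m * (M * D + b).
  move: h; rewrite -!mulnn !mulnDr !mulnDl. lia.
by rewrite leq_pmul2l //; lia.
Qed.

Lemma exists_balanced (T : finType) (d : nat) (K : 'I_d -> finType)
    (key : forall i, T -> K i) (m : 'I_d -> nat) (M N : nat) :
  (forall i, 0 < m i) ->
  exists b : T -> 'I_d -> nat,
    let c p := \sum_i m i * b p i in
    (forall p i, \sum_(q | key i q == key i p) b q i = N) /\
    forall p q i, key i p = key i q -> 0 < b p i ->
      b p i + M * c p <= b q i + M * c q + (M * m i + 1).
Proof.
move=> m0.
pose feas (b : T -> 'I_d -> nat) :=
  forall p i, \sum_(q | key i q == key i p) b q i = N.
pose e (b : T -> 'I_d -> nat) p :=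
  M * (\sum_i m i * b p i) ^ 2 + \sum_i m i * b p i ^ 2.
have [b0 feas0] : exists b, feas b.
  (* One representative of each line receives the whole mass [N]. *)
  exists (fun p i => if [pick q | key i q == key i p] == Some p then N else 0).
  move=> p i; have [r pickr rp] : exists2 r,
      [pick q | key i q == key i p] = Some r & key i r = key i p.
    case: pickP => [r /eqP rp|/(_ p)]; first by exists r.
    by rewrite eqxx.
  transitivity (\sum_(q | key i q == key i p) if q == r then N else 0).
    apply: eq_bigr => q /eqP qp; rewrite qp pickr eq_sym.
    by rewrite (inj_eq (@Some_inj _)).
  by rewrite -big_mkcondr /= (big_pred1 r) // => q /=;
    case: (eqVneq q r) => [->|]; rewrite ?rp ?eqxx ?andbF.
have exE : exists k, `[< exists2 b, feas b & \sum_p e b p = k >].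
  by exists (\sum_p e b0 p); apply/asboolP; exists b0.
case: (ex_minnP exE) => k /asboolP[b feasb bk] kmin; exists b => c.
split=> // p q i pq b_gt0.
have [->|qp] := eqVneq q p; first by rewrite leq_addr.
(* Compare with the assignment moving one unit from [p] to [q] along the line. *)
pose b' r j := if j == i then
   if r == p then (b p i).-1 else if r == q then (b q i).+1 else b r j
   else b r j.
have feasb' : feas b'.
  move=> r j; rewrite /b'; case: (eqVneq j i) => [->|_]; last exact: feasb.
  have [rp|rp] := eqVneq (key i r) (key i p); last first.
    rewrite -(feasb r i); apply: eq_bigr => s /eqP sr; case: eqP => [sp|_].
      by move: rp; rewrite -sr sp eqxx.
    by case: eqP => // sq; move: rp; rewrite -sr sq pq eqxx.
  rewrite -(feasb r i) rp (bigD1 p) //= (bigD1 q) ?pq ?eqxx ?qp //=.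
  rewrite [X in _ = X](bigD1 p) ?pq //= [X in _ = _ + X](bigD1 q) ?eqxx ?qp //=.
  rewrite (negPf qp) !addnA; congr (_ + _); first lia.
  by apply: eq_bigr => s /andP[/andP[_ /negPf->] /negPf->].
have le_e : e b p + e b q <= e b' p + e b' q.
  have : \sum_p e b p <= \sum_p e b' p.
    by rewrite bk; apply: kmin; apply/asboolP; exists b'.
  rewrite (bigD1 p) //= (bigD1 q) ?qp //= [X in _ <= X](bigD1 p) //=.
  rewrite [X in _ <= _ + X](bigD1 q) ?qp //= !addnA.
  rewrite [X in _ <= _ + X](eq_bigr (e b)) ?leq_add2r // => r /andP[/negPf rp /negPf rq].
  rewrite /e /b'; congr (_ * _ ^ _ + _); apply: eq_bigr => j _;
    by case: eqP => // ->; rewrite rp rq.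
have split_i (f : 'I_d -> nat) : \sum_j f j = f i + \sum_(j | j != i) f j.
  by rewrite (bigD1 i).
have b'E r j : j != i -> b' r j = b r j by rewrite /b' => /negPf->.
have b'p : b' p i = (b p i).-1 by rewrite /b' !eqxx.
have b'q : b' q i = (b q i).+1 by rewrite /b' eqxx (negPf qp) eqxx.
move: le_e; rewrite /c /e !split_i.
have rest r (f : nat -> nat) :
    \sum_(j | j != i) m j * f (b' r j) = \sum_(j | j != i) m j * f (b r j).
  by apply: eq_bigr => j ji; rewrite b'E.
rewrite !(rest _ id) !(rest _ (fun x => x ^ 2)) b'p b'q.
move: (\sum_(_ | _) _) (\sum_(_ | _) _) (\sum_(_ | _) _) (\sum_(_ | _) _).
move=> A1 A2 Y X h; apply: (energy_transfer (m0 i) b_gt0); move: h; lia.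
Qed.

Lemma sum_le_card_fibers (T : finType) (K : finType) (key : T -> K) (f : T -> nat) (N : nat) :
  (forall p, \sum_(q | key q == key p) f q = N) -> \sum_p f p <= #|K| * N.
Proof.
move=> fN; rewrite (partition_big key xpredT) //= -sum_nat_const.
apply: leq_sum => k _; have [/existsP[p /eqP <-]|] := boolP [exists p, key p == k].
  by rewrite fN.
by rewrite negb_exists => /forallP nk; rewrite big_pred0 // => p; exact: negPf.
Qed.

(** All geometry sits in the hypothesis. It is applied with [n = M * M - 1], handicaps [M * c p] and
    numbers [b p i + k], where [k] absorbs the error in the balance. *)
Lemma card_multijoint_bound (T : finType) (d : nat) (K : 'I_d -> finType)
    (key : forall i, T -> K i) : 0 < #|T| ->
  (forall (S : {set T}) n (beta : T -> nat) (b : T -> 'I_d -> nat),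
     S != set0 ->
     (forall p i, p \in S ->
        n < \sum_(q in S | key i p == key i q) (b p i + beta p - beta q)) ->
     'C(d + n, d) <= \sum_(p in S) \prod_i b p i) ->
  #|T| ^ d.-1 <= d`! * \prod_i #|K i|.
Proof.
move=> T0 hb.
have [d0|d_gt0] := posnP d.
  by subst d; rewrite expn0 big_ord0.
pose P := \prod_i #|K i|.
(* With these weights [m i * #|K i| = P] for every [i], so each family adds at most [P * (M * M)] to
   the sum of [c]. *)
pose m i := \prod_(j | j != i) #|K j|.
have K0 i : 0 < #|K i| by case/card_gt0P: T0 => p _; apply/card_gt0P; exists (key i p).
have m0 i : 0 < m i by apply: prodn_gt0.
have mK i : m i * #|K i| = P by rewrite /P (bigD1 i) //= mulnC.
have mP i : m i <= P by rewrite -(mK i) leq_pmulr.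
have sum_m : \sum_i m i <= d * P.
  by apply: leq_trans (leq_sum _ (fun i _ => mP i)) _; rewrite sum_nat_const card_ord.
pose t := #|T|.
(* The first term pays for the spread of [c] on [S], the second for the shift of [b] by [k]; both
   are lower order in [M]. *)
pose D := t ^ 2 * (P + 2) + t * (P + 1) * (d * P).
suff /leading_coef_le : forall M, 0 < M ->
    t ^ d.-1 * d ^ d * \prod_i m i * M ^ d <= d`! * (d * P * M + D) ^ d.
  have -> : (d * P) ^ d = d ^ d * \prod_i m i * P.
    rewrite expnMn -mulnA; congr (_ * _); rewrite {2}/P -big_split /=.
    by rewrite (eq_bigr (fun=> P)) ?prod_nat_const ?card_ord // => i _; exact: mK.
  have X0 : 0 < d ^ d * \prod_i m i by rewrite muln_gt0 expn_gt0 d_gt0 prodn_gt0.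
  move=> h; rewrite -(leq_pmul2l X0); move: h; rewrite -/P -/t.
  by move: (t ^ _) (d ^ d) (\prod_i m i) (d`!) => x y z w; lia.
move=> M M0.
have [b [bsum bal]] := exists_balanced key M (M * M) m0.
pose c p := \sum_i m i * b p i; rewrite -/(c _) in bal.
(* [k] bounds every error [M * m i + 1]. A difference of [c] above [g], multiplied by [M], exceeds
   [M * M + k], the most that the balance allows when [b q i] is positive. *)
pose k := M * P + 1; pose g := M + P + 1.
have [S [S0 Sc Sgap]] := exists_gap c g T0.
have ble p i : b p i <= M * M.
  by rewrite -(bsum p i) (bigD1 p) //= leq_addr.
have b_out p q i : p \in S -> q \notin S -> key i p = key i q -> b q i = 0.
  move=> pS qS pq; apply/eqP; rewrite -leqn0 leqNgt; apply/negP => bq.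
  have := bal q p i (esym pq) bq; have := ble p i; have := Sgap p q pS qS.
  rewrite -!/(c _) /g; have := mP i; move: (c p) (c q) (m i) (b p i) (b q i) bq.
  move=> cp cq mi bp bq bq0 h1 h2 h3.
  have : M * (cp + (M + P + 1)).+1 <= M * cq by rewrite leq_pmul2l.
  have : M * mi <= M * P by rewrite leq_pmul2l.
  nia.
(* By the balance between [q] and [p] each summand is at least [b q i], and by [b_out] these already
   add up to [M * M] over [S]. *)
have /hb : forall p i, p \in S ->
    (M * M).-1 < \sum_(q in S | key i p == key i q)
       ((b p i + k) + M * c p - M * c q).
  move=> p i pS; rewrite prednK ?muln_gt0 ?M0 //.
  rewrite -{1}(bsum p i) (bigID (mem S)) /=.
  rewrite [X in _ + X]big1 => [|q /andP[/eqP qp qS]]; last exact: (b_out p).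
  rewrite addn0 (eq_bigl (fun q => (q \in S) && (key i p == key i q))); last first.
    by move=> q; rewrite andbC eq_sym.
  apply: leq_sum => q /andP[qS /eqP pq].
  have [->//|b0] := posnP (b q i).
  have := bal q p i (esym pq) b0; rewrite -!/(c _) /k.
  have : M * m i <= M * P by rewrite leq_pmul2l.
  lia.
move/(_ S0) => hC.
have sumc : \sum_p c p <= d * P * (M * M).
  rewrite /c exchange_big /= -mulnA -[d in leqRHS]card_ord -sum_nat_const.
  apply: leq_sum => i _; rewrite -big_distrr /= -(mK i) -mulnA leq_mul2l.
  by rewrite (@sum_le_card_fibers _ _ (key i) _ (M * M)) ?orbT.
(* On [S], [c p] exceeds any [c q] by at most [t * g]; summing over all [q] compares it with the
   mean of [c]. *)
have tc p : p \in S -> t * (c p + k * \sum_i m i) <= M * (d * P * M + D).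
  move=> pS; have tcp : t * c p <= d * P * (M * M) + t * (t * g).
    apply: leq_trans (_ : \sum_q (c q + t * g) <= _).
      by rewrite -sum_nat_const; apply: leq_sum => q _; exact: Sc.
    by rewrite big_split /= sum_nat_const leq_add2r.
  have kM : k <= M * (P + 1) by rewrite /k; lia.
  have gM : g <= M * (P + 2) by rewrite /g; nia.
  rewrite mulnDr /D.
  have := leq_mul (leqnn t) (leq_mul kM sum_m).
  have := leq_mul (leqnn t) (leq_mul (leqnn t) gM).
  move: tcp; move: (d * P) (k * _) => x y; lia.
(* Arithmetic-geometric mean for the factors [m i * (b p i + k)], whose sum is
   [c p + k * \sum_i m i]. *)
have Wp p : p \in S ->
    t ^ d * (d ^ d * \prod_i m i * \prod_i (b p i + k)) <= M ^ d * (d * P * M + D) ^ d.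
  move=> pS; rewrite -[X in _ * X]mulnA -big_split /= -expnMn.
  apply: leq_trans (leq_mul (leqnn _) (leq_AGM _)) _; rewrite -expnMn leq_exp2r //.
  apply: leq_trans (tc p pS); rewrite leq_mul2l; apply/orP; right.
  rewrite /c big_distrr -big_split /=; apply/eq_leq/eq_bigr => i _; lia.
have hS : t ^ d * (d ^ d * \prod_i m i) * 'C(d + (M * M).-1, d) <=
    t * (M ^ d * (d * P * M + D) ^ d).
  apply: leq_trans (leq_mul (leqnn _) hC) _; rewrite big_distrr /=.
  apply: leq_trans (_ : \sum_(p in S) M ^ d * (d * P * M + D) ^ d <= _).
    by apply: leq_sum => p pS; rewrite -mulnA; exact: Wp.
  by rewrite sum_nat_const leq_mul2r max_card orbT.
(* Since [n.+1 = M * M], the binomial times [d!] is at least [M ^ (2 * d)]; cancelling [t * M ^ d]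
   then gives the goal. *)
have := leq_mul (leqnn (t ^ d * (d ^ d * \prod_i m i)))
   (expn_leq_ffact d (M * M).-1).
rewrite prednK ?muln_gt0 ?M0 // -bin_ffact => h1.
have := leq_trans h1 (_ : _ <= t * (M ^ d * (d * P * M + D) ^ d) * d`!).
rewrite mulnA leq_mul2r hS orbT => /(_ isT).
rewrite expnMn -{1}(prednK d_gt0) expnS => h2.
rewrite -(leq_pmul2l (_ : 0 < t * M ^ d)) ?muln_gt0 ?T0 ?expn_gt0 ?M0 //.
move: h2; rewrite -/t; congr (_ <= _); last by rewrite mulnC !mulnA [_ * d`!]mulnC; lia.
by rewrite !mulnA; lia.
Qed.

End Combinatorics.

(** * Polynomials vanishing along the lines *)

Section Polynomials.
Import mpoly.
Local Open Scope ring_scope.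

(* The substitution [X := a + X *m B] on row vectors. *)
Definition affine_subst (F : fieldType) (d : nat) (a : 'rV[F]_d) (B : 'M[F]_d) :
    d.-tuple {mpoly F[d]} :=
  [tuple (a 0 j)%:MP + \sum_i B i j *: 'X_i | j < d].

(** Used to recentre an expansion at another point and to change its basis. *)
Lemma affine_subst_comp (F : fieldType) (d : nat) (g : {mpoly F[d]})
    (a a' : 'rV[F]_d) (B B' : 'M[F]_d) :
  (g \mPo affine_subst a B) \mPo affine_subst a' B' = g \mPo affine_subst (a + a' *m B) (B' *m B).
Proof.
rewrite (comp_mpolyEX g) [RHS]comp_mpolyEX raddf_sum /=; apply: eq_bigr => m _.
rewrite !comp_mpolyZ !comp_mpolyX rmorph_prod /=; congr (_ *: _).
apply: eq_bigr => j _; rewrite rmorphXn /=; congr (_ ^+ _).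
rewrite !tnth_mktuple rmorphD /= comp_mpolyC raddf_sum /= !mxE mpolyCD -addrA.
congr (_ + _); rewrite rmorph_sum /=.
transitivity (\sum_i ((a' 0 i * B i j)%:MP_[d] +
   \sum_k (B' k i * B i j) *: ('X_k : {mpoly F[d]}))).
  apply: eq_bigr => i _; rewrite comp_mpolyZ comp_mpolyXU -tnth_nth tnth_mktuple.
  rewrite scalerDr -mul_mpolyC -mpolyCM mulrC; congr (_ + _).
  by rewrite scaler_sumr; apply: eq_bigr => k _; rewrite scalerA mulrC.
rewrite big_split /=; congr (_ + _).
rewrite exchange_big /=; apply: eq_bigr => k _.
by rewrite mxE scaler_suml.
Qed.

Lemma affine_subst_id (F : fieldType) (d : nat) (g : {mpoly F[d]}) :
  g \mPo affine_subst 0 1%:M = g.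
Proof.
rewrite -[RHS]comp_mpoly_id; congr (_ \mPo _).
apply: eq_from_tnth => j; rewrite !tnth_mktuple mxE mpolyC0 add0r.
rewrite (bigD1 j) //= mxE eqxx scale1r big1 ?addr0 // => i /negPf ij.
by rewrite mxE ij scale0r.
Qed.

Lemma affine_subst_neq0 (F : fieldType) (d : nat) (g : {mpoly F[d]}) a (B : 'M[F]_d) :
  B \in unitmx -> g != 0 -> g \mPo affine_subst a B != 0.
Proof.
move=> uB; apply: contraNneq => gB0.
have := affine_subst_comp g a (- a *m invmx B) B (invmx B).
by rewrite gB0 comp_mpoly0 mulmxKV // mulVmx // subrr affine_subst_id => <-.
Qed.

Lemma msize_prod_le (F : fieldType) (d : nat) (I : Type) (s : seq I)
    (f : I -> {mpoly F[d]}) (k : I -> nat) :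
  (forall i, msize (f i) <= (k i).+1)%N ->
  (msize (\prod_(i <- s) f i) <= (\sum_(i <- s) k i).+1)%N.
Proof.
move=> fk; elim: s => [|i s IH]; first by rewrite !big_nil msize1.
rewrite !big_cons.
have [->|nf] := eqVneq (f i) 0; first by rewrite mul0r msize0.
have [->|nr] := eqVneq (\prod_(j <- s) f j) 0; first by rewrite mulr0 msize0.
rewrite msizeM // -subn1 leq_subLR add1n -addnS -addSn.
exact: leq_add.
Qed.

Lemma msize_affine_subst (F : fieldType) (d : nat) (g : {mpoly F[d]}) a (B : 'M[F]_d) :
  (msize (g \mPo affine_subst a B) <= msize g)%N.
Proof.
have s1 j : (msize (tnth (affine_subst a B) j) <= 2)%N.
  rewrite tnth_mktuple; apply: leq_trans (msizeD_le _ _) _.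
  rewrite geq_max; apply/andP; split.
    by rewrite msizeC; case: (_ == 0).
  apply: leq_trans (msize_sum _ _ _) _.
  apply/bigmax_leqP_seq => i _ _.
  by apply: leq_trans (msizeZ_le _ _) _; rewrite msizeX mdeg1.
have sX j k : (msize (tnth (affine_subst a B) j ^+ k) <= k.+1)%N.
  have := msize_prod_le (nseq k tt) (f := fun=> tnth (affine_subst a B) j)
     (k := fun=> 1%N) (fun=> s1 j).
  rewrite big_const_seq count_predT size_nseq.
  by rewrite big_const_seq count_predT size_nseq iter_addn_0 mul1n -Monoid.iteropE.
rewrite comp_mpolyE; apply: leq_trans (msize_sum _ _ _) _.
apply/bigmax_leqP_seq => m mg _.
apply: leq_trans (msizeZ_le _ _) _.
apply: leq_trans (msize_mdeg_lt mg); rewrite mdegE.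
by apply: (msize_prod_le _ (k := fun i => m i)) => j; apply: sX.
Qed.

(** * Order of vanishing and Hasse derivatives on a line *)

Definition vanishes (F : fieldType) (d r : nat) (g : {mpoly F[d]}) : Prop :=
  forall m, (mdeg m < r)%N -> g@_m = 0.

(** A linear substitution sends a monomial to a form of the same degree, so no term of degree below
    [r] appears. *)
Lemma vanishes_linear (F : fieldType) (d r : nat) (g : {mpoly F[d]}) (B : 'M[F]_d) :
  vanishes r g -> vanishes r (g \mPo affine_subst 0 B).
Proof.
move=> vg m mr; rewrite comp_mpolyE raddf_sum /= big1_seq // => m' /andP[_ m'g].
rewrite mcoeffZ [X in _ * X](@dhomog_nemf_coeff _ _ mdeg (mdeg m')) ?mulr0 //.
  rewrite mdegE; elim/big_rec2: _ => [|i q k _ hq]; first exact: dhomog1.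
  apply: dhomogM hq; rewrite -{2}[m' i]mul1n; apply: dhomogMn.
  rewrite tnth_mktuple mxE mpolyC0 add0r; apply: rpred_sum => j _.
  by apply: rpredZ; rewrite dhomogX; apply/eqP; exact: mdeg1.
apply: contraTneq m'g => m'm; rewrite mcoeff_msupp negbK.
by rewrite vg // -m'm.
Qed.

(* For [c i = 0] this is the Hasse derivative of [g] of multi-index [c],
   restricted to the [i]-th coordinate axis. *)
Definition slice (F : fieldType) (d : nat) (i : 'I_d) (c : 'X_{1..d})
    (g : {mpoly F[d]}) : {poly F} :=
  \poly_(k < msize g) g@_(c + U_(i) *+ k).

Lemma coef_slice (F : fieldType) (d : nat) (i : 'I_d) (c : 'X_{1..d})
    (g : {mpoly F[d]}) k : (slice i c g)`_k = g@_(c + U_(i) *+ k).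
Proof.
rewrite coef_poly; case: ltnP => // gk; apply/esym/eqP.
rewrite mcoeff_eq0; apply: msize_mdeg_ge; apply: leq_trans gk _.
by rewrite mdegD mdegMn mdeg1 mul1n leq_addl.
Qed.

Lemma slice_sum (F : fieldType) (d : nat) (i : 'I_d) (c : 'X_{1..d})
    (I : Type) (s : seq I) (a : I -> F) (f : I -> {mpoly F[d]}) :
  slice i c (\sum_(j <- s) a j *: f j) = \sum_(j <- s) a j *: slice i c (f j).
Proof.
apply/polyP => k; rewrite coef_slice !raddf_sum coef_sum; apply: eq_bigr => j _.
by rewrite /= mcoeffZ coefZ coef_slice.
Qed.

(** By linearity take a monomial: the shift affects only its [i]-th factor, and both sides become
    the same binomial expansion. *)
Lemma slice_shift (F : fieldType) (d : nat) (i : 'I_d) (c : 'X_{1..d})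
    (g : {mpoly F[d]}) (s : F) : c i = 0%N ->
  slice i c (g \mPo affine_subst (s *: delta_mx 0 i) 1%:M) = slice i c g \Po ('X + s%:P).
Proof.
move=> ci; rewrite {2}[g]mpolyE comp_mpolyEX !slice_sum raddf_sum /=.
apply: eq_bigr => m _; rewrite comp_polyZ; congr (_ *: _).
pose m' : 'X_{1..d} := [multinom if j == i then 0%N else m j | j < d].
have mE : m = (m' + U_(i) *+ m i)%MM.
  apply/mnmP => j; rewrite mnmDE mulmnE mnm1E mnmE.
  by case: (eqVneq j i) => [->|_]; rewrite ?mul1n ?mul0n ?addn0.
have m'i : m' i = 0%N by rewrite mnmE eqxx.
(* As [m' i] and [c i] are both zero, the [i]-th exponents alone force [k = l]. *)
have cancelU k l : ((m' + U_(i) *+ k)%MM == (c + U_(i) *+ l)%MM) =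
    (m' == c) && (k == l).
  apply/eqP/andP => [/mnmP e|[/eqP-> /eqP->] //].
  have kl : k = l.
    by have := e i; rewrite !mnmDE !mulmnE mnm1E eqxx m'i ci !mul1n.
  split; last exact/eqP; apply/eqP/mnmP => j.
  by have /eqP := e j; rewrite !mnmDE kl eqn_add2r => /eqP.
have XE : 'X_[m] \mPo affine_subst (s *: delta_mx 0 i) 1%:M =
    'X_[m'] * (s%:MP + 'X_i) ^+ m i :> {mpoly F[d]}.
  rewrite comp_mpolyX (mpolyXE_id F m') (bigD1 i) //= [in RHS](bigD1 i) //=.
  rewrite m'i expr0 mul1r mulrC; congr (_ * _ ^+ _).
    apply: eq_bigr => j /negPf ji; rewrite tnth_mktuple mnmE ji !mxE ji andbF.
    rewrite mulr0 mpolyC0 add0r (bigD1 j) //= mxE eqxx scale1r big1 ?addr0 //.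
    by move=> k /negPf kj; rewrite mxE kj scale0r.
  rewrite tnth_mktuple !mxE !eqxx mulr1; congr (_ + _).
  rewrite (bigD1 i) //= mxE eqxx scale1r big1 ?addr0 //.
  by move=> k /negPf kj; rewrite mxE kj scale0r.
have sX k : slice i c 'X_[m' + U_(i) *+ k] = (m' == c)%:R *: 'X^k.
  apply/polyP => l; rewrite coef_slice mcoeffX cancelU coefZ coefXn.
  by rewrite [l == _]eq_sym; case: (m' == c); rewrite ?mul1r ?mul0r.
rewrite [in RHS]mE sX comp_polyZ comp_Xn_poly XE exprDn mulr_sumr.
transitivity (slice i c (\sum_(k < (m i).+1)
    (s ^+ (m i - k) *+ 'C(m i, k)) *: 'X_[m' + U_(i) *+ k])).
  congr slice; apply: eq_bigr => k _.
  by rewrite mpolyXD -mpolyXn -scalerMnl mulrnAr -rmorphXn /= mulrCA mul_mpolyC.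
rewrite slice_sum [_ + s%:P]addrC exprDn scaler_sumr; apply: eq_bigr => k _.
rewrite sX scalerA mulrC -scalerA -rmorphXn /= mul_polyC.
by rewrite -scalerMnl.
Qed.

(** After the shift, the [k]-th coefficient of the slice comes from a monomial of degree
    [mdeg c + k], hence is zero for [k < r - mdeg c]. Shifting back moves the zero to [s]. *)
Lemma vanishes_slice (F : fieldType) (d r : nat) (i : 'I_d) (c : 'X_{1..d})
    (g : {mpoly F[d]}) (s : F) : c i = 0%N ->
  vanishes r (g \mPo affine_subst (s *: delta_mx 0 i) 1%:M) ->
  ('X - s%:P) ^+ (r - mdeg c) %| slice i c g.
Proof.
move=> ci vg; set e := (r - mdeg c)%N.
have : 'X^e %| slice i c g \Po ('X + s%:P).
  rewrite -slice_shift //; set q := slice _ _ _.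
  have -> : q = drop_poly e q * 'X^e; last exact: dvdp_mull.
  rewrite -[LHS](poly_take_drop e) -[RHS]add0r; congr (_ + _).
  apply/polyP => k; rewrite coef_take_poly coef0; case: ltnP => // ke.
  rewrite coef_slice vg // mdegD mdegMn mdeg1 mul1n.
  by rewrite -ltn_subRL.
case/dvdpP => q qE; apply/dvdpP; exists (q \Po ('X - s%:P)).
rewrite -[LHS]comp_polyXr -[X in _ \Po X](addrNK s%:P).
have -> : 'X - s%:P + s%:P = ('X + s%:P) \Po ('X - s%:P).
  by rewrite comp_polyD comp_polyX comp_polyC.
by rewrite comp_polyA qE comp_polyM comp_Xn_poly.
Qed.

(* Among the points, take [p] minimising [ord_p g + beta p]; a lowest-order term
   of [g] at [p] has a large exponent in some direction [i], and the corresponding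
   derivative of [g], restricted to the [i]-th line through [p], has more zeros
   than its degree allows. *)
Lemma handicap_vanishing (F : fieldType) (d n : nat) (T : finType) (S : {set T})
    (x : T -> 'rV[F]_d) (B : T -> 'M[F]_d) (line : 'I_d -> rel T)
    (beta : T -> nat) (b : T -> 'I_d -> nat) (g : {mpoly F[d]}) :
  injective x ->
  (forall p, p \in S -> B p \in unitmx) ->
  (forall p q i, p \in S -> q \in S -> line i p q ->
     exists s, x q = x p + s *: row i (B p)) ->
  (forall p i, p \in S ->
     n < \sum_(q in S | line i p q) (b p i + beta p - beta q))%N ->
  S != set0 -> (msize g <= n.+1)%N ->
  (forall p (m : 'X_{1..d}), p \in S -> (forall i, m i < b p i)%N ->
     (g \mPo affine_subst (x p) (B p))@_m = 0) ->
  g = 0.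
Proof.
move=> xI uB xline bsum /set0Pn[p0 p0S] gn gb.
have [//|g0] := eqVneq g 0; exfalso.
pose G p := g \mPo affine_subst (x p) (B p).
have G0 p : p \in S -> G p != 0 by move=> pS; apply: affine_subst_neq0; rewrite ?uB.
(* [r] is the exact order of [g] at [x p]; off [S] it is set to [0]. *)
have ordP p : exists r, p \in S -> vanishes r (G p) /\
    exists2 m, mdeg m = r & (G p)@_m != 0.
  have [pS|] := boolP (p \in S); last by exists 0%N.
  have exr : exists r, has (fun m => mdeg m == r) (msupp (G p)).
    have := G0 p pS; rewrite -msupp_eq0; case E: msupp => [//|m s] _.
    by exists (mdeg m); rewrite /= eqxx.
  case: (ex_minnP exr) => r /hasP[m mG /eqP mr] rmin; exists r => _; split.
    move=> m' m'r; apply/eqP; rewrite mcoeff_eq0; apply: contraL m'r => m'G.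
    by rewrite -leqNgt; apply: rmin; apply/hasP; exists m'.
  by exists m => //; rewrite -mcoeff_msupp.
have {ordP} [ord ordP] := fin_all_exists ordP.
case: (arg_minnP (fun p => ord p + beta p)%N p0S) => p pS pmin.
have [_ [m mord Gm]] := ordP p pS.
have [i bi] : exists i, (b p i <= m i)%N.
  apply/existsP; apply: contraR Gm; rewrite negb_exists => /forallP mb.
  by apply/eqP/gb => // i; rewrite ltnNge mb.
pose c : 'X_{1..d} := [multinom if j == i then 0%N else m j | j < d].
have mE : m = (c + U_(i) *+ m i)%MM.
  apply/mnmP => j; rewrite mnmDE mulmnE mnm1E mnmE.
  by case: (eqVneq j i) => [->|_]; rewrite ?mul1n ?mul0n ?addn0.
have ci : c i = 0%N by rewrite mnmE eqxx.
have mdegc : (mdeg c + m i)%N = ord p.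
  by rewrite -mord {2}mE mdegD mdegMn mdeg1 mul1n.
pose h := slice i c (G p).
have h0 : h != 0.
  by apply: contraNneq Gm => h0; rewrite mE -coef_slice -/h h0 coef0.
have sh q : exists s, q \in S -> line i p q -> x q = x p + s *: row i (B p).
  have [qS|] := boolP (q \in S); last by exists 0.
  have [pq|] := boolP (line i p q); last by exists 0.
  by have [s ?] := xline p q i pS qS pq; exists s.
have {sh} [s sP] := fin_all_exists sh.
have dvd q : q \in S -> line i p q ->
    ('X - (s q)%:P) ^+ (b p i + beta p - beta q) %| h.
  move=> qS pq.
  (* Minimality of [p] gives [ord q + beta q >= mdeg c + m i + beta p], and [m i >= b p i]. *)
  suff: vanishes (ord q) (G p \mPo affine_subst (s q *: delta_mx 0 i) 1%:M).
    move/(vanishes_slice ci); apply: dvdp_trans; apply: dvdp_exp2l.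
    have := pmin q qS; rewrite -mdegc; lia.
  (* Once centred at [x q], the expansions in the bases of [p] and [q] differ by a linear change of
     coordinates, which preserves the order. *)
  have -> : G p \mPo affine_subst (s q *: delta_mx 0 i) 1%:M =
      G q \mPo affine_subst 0 (B p *m invmx (B q)).
    rewrite !affine_subst_comp mul0mx addr0 mul1mx mulmxKV ?uB // (sP q) //.
    by rewrite -scalemxAl -rowE.
  by apply: vanishes_linear; case: (ordP q qS).
pose Q := \prod_(q in S | line i p q) ('X - (s q)%:P) ^+ (b p i + beta p - beta q).
(* Injectivity of [x] makes the parameters [s q] distinct, so the factors are pairwise coprime. *)
have Qh : Q %| h.
  rewrite /Q -big_filter; set r := filter _ _.
  have ur : uniq r by rewrite filter_uniq // index_enum_uniq.
  have rP q : q \in r -> q \in S /\ line i p q.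
    by rewrite mem_filter => /andP[/andP[]].
  elim: r ur rP => [|q r IH] /=; first by rewrite big_nil dvd1p.
  case/andP=> qr ur rP; rewrite big_cons Gauss_dvdp.
    have [qS pq] := rP q (mem_head _ _).
    rewrite dvd //=; apply: IH => // q' q'r.
    by apply: rP; rewrite inE q'r orbT.
  rewrite big_seq; apply: (big_ind (fun u => coprimep _ u)).
  - exact: coprimep1.
  - by move=> u v; rewrite coprimepMr => -> ->.
  move=> q' q'r; apply/coprimep_expl/coprimep_expr.
  rewrite coprimep_XsubC2 // subr_eq0; apply: contraNneq qr => sqq.
  suff <- : q' = q by [].
  have [q'S pq'] : q' \in S /\ line i p q' by apply: rP; rewrite inE q'r orbT.
  have [qS pq] := rP q (mem_head _ _).
  by apply: xI; rewrite (sP q') // (sP q) // sqq.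
have := dvdp_leq h0 Qh; apply/negP; rewrite -ltnNge.
apply: (@leq_ltn_trans n.+1).
  apply: leq_trans (size_poly _ _) _; apply: leq_trans gn; exact: msize_affine_subst.
rewrite /Q size_prod => [|q _]; last by rewrite expf_neq0 // polyXsubC_eq0.
apply: leq_trans (_ : (\sum_(q in S | line i p q) (b p i + beta p - beta q)).+1 <= _)%N.
  by rewrite ltnS bsum.
under [X in (_ < X.+1 - _)%N]eq_bigr do rewrite size_exp_XsubC -addn1.
by rewrite big_split /= sum1_card -addSn addnK.
Qed.

(** * Counting coefficients against conditions *)

Lemma card_box_le (d W : nat) (b : 'I_d -> nat) :
  (#|[set f : {ffun 'I_d -> 'I_W} | [forall i, f i < b i]]| <= \prod_i b i)%N.
Proof.
rewrite (eq_card (B := family (fun i => [pred k : 'I_W | k < b i]%N))); last first.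
  by move=> f; rewrite !inE; apply: eq_forallb.
rewrite card_family foldrE big_map big_enum /=.
apply: leq_prod => i _; rewrite cardE -(size_map val) -[b i in leqRHS](size_iota 0).
apply: uniq_leq_size; first by rewrite map_inj_uniq ?enum_uniq //; exact: val_inj.
by move=> _ /mapP[k + ->]; rewrite mem_enum mem_iota.
Qed.

(** There are more monomials of degree at most [n] than linear conditions, so the matrix of
    conditions has a nonzero left kernel. *)
Lemma exists_mpoly_coef0 (F : fieldType) (d n : nat) (T : finType) (S : {set T})
    (phi : T -> {linear {mpoly F[d]} -> {mpoly F[d]}}) (b : T -> 'I_d -> nat) :
  (\sum_(p in S) \prod_i b p i < 'C(d + n, d))%N ->
  exists2 g : {mpoly F[d]}, g != 0 & (msize g <= n.+1)%N /\
    forall p (m : 'X_{1..d}), p \in S -> (forall i, m i < b p i)%N -> (phi p g)@_m = 0.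
Proof.
move=> lt_card.
pose mon := [set t : d.-tuple 'I_n.+1 | (\sum_(i <- t) i <= n)%N].
(* A common bound on the exponents, so that the conditions are indexed by a finite type. *)
pose W := (\max_(p in S) \max_i b p i)%N.
pose Q := [set q : T * {ffun 'I_d -> 'I_W} |
   (q.1 \in S) && [forall i, q.2 i < b q.1 i]%N].
have cardQ : (#|Q| <= \sum_(p in S) \prod_i b p i)%N.
  rewrite -sum1_card (eq_bigl (fun q : T * {ffun 'I_d -> 'I_W} =>
    (q.1 \in S) && [forall i, q.2 i < b q.1 i]%N)); last by move=> q; rewrite inE.
  rewrite -(pair_big_dep (mem S)
    (fun p (f : {ffun 'I_d -> 'I_W}) => [forall i, f i < b p i]%N) (fun _ _ => 1%N)) /=.
  apply: leq_sum => p _; apply: leq_trans (card_box_le W (b p)).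
  by rewrite sum1dep_card cardsE.
have cardmon : #|mon| = 'C(d + n, d) := card_partial_ord_partitions d n.
pose mu (t : d.-tuple 'I_n.+1) : 'X_{1..d} := [multinom (tnth t i : nat) | i < d].
pose nu (f : {ffun 'I_d -> 'I_W}) : 'X_{1..d} := [multinom (f i : nat) | i < d].
pose A : 'M[F]_(#|mon|, #|Q|) := \matrix_(t, q)
  (phi (enum_val q).1 'X_[mu (enum_val t)])@_(nu (enum_val q).2).
have AE t q : A t q = (phi (enum_val q).1 'X_[mu (enum_val t)])@_(nu (enum_val q).2).
  by rewrite mxE.
have kerA : kermx A != 0.
  rewrite -mxrank_eq0 mxrank_ker subn_eq0 -ltnNge.
  by apply: leq_ltn_trans (rank_leq_col A) _; rewrite cardmon; apply: leq_ltn_trans lt_card.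
have [r rA] : exists r, row r (kermx A) != 0.
  apply/existsP; apply: contraNT kerA; rewrite negb_exists => /forallP r0.
  by apply/eqP/row_matrixP => r; rewrite row0; apply/eqP; have := r0 r; rewrite negbK.
pose v := row r (kermx A).
have vA : v *m A = 0 by rewrite -row_mul mulmx_ker row0.
have mu_inj : injective mu.
  move=> t t' /mnmP e; apply: eq_from_tnth => i; apply: val_inj.
  by have := e i; rewrite !mnmE.
pose g : {mpoly F[d]} := \sum_t v 0 t *: 'X_[mu (enum_val t)].
have gcoef t : g@_(mu (enum_val t)) = v 0 t.
  rewrite raddf_sum (bigD1 t) //= mcoeffZ mcoeffX eqxx mulr1 big1 ?addr0 // => t' tt'.
  rewrite mcoeffZ mcoeffX [_ == _]negbTE ?mulr0 //; apply: contraNneq tt'.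
  by move/mu_inj/enum_val_inj->.
exists g; last split.
- by apply: contraNneq rA => g0; apply/eqP/rowP => t; rewrite -/v -gcoef g0 mcoeff0 mxE.
- apply: leq_trans (msize_sum _ _ _) _; apply/bigmax_leqP_seq => t _ _.
  apply: leq_trans (msizeZ_le _ _) _; rewrite msizeX ltnS mdegE.
  have := enum_valP t; rewrite inE big_tuple; congr (_ <= _)%N.
  by apply: eq_bigr => i _; rewrite mnmE.
move=> p m pS mb.
have mW i : (m i < W)%N.
  apply: leq_trans (mb i) _; apply: leq_trans (leq_bigmax_cond _ pS).
  exact: leq_bigmax_cond.
pose f := [ffun i => Ordinal (mW i)].
have pfQ : (p, f) \in Q.
  by rewrite inE pS; apply/forallP => i; rewrite ffunE mb.
have -> : m = nu f by apply/mnmP => i; rewrite mnmE ffunE.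
have := congr1 (fun w : 'rV_ _ => w 0 (enum_rank_in pfQ (p, f))) vA.
rewrite [LHS]mxE [RHS]mxE => <-; rewrite !raddf_sum; apply: eq_bigr => t _.
by rewrite /= linearZ mcoeffZ -/(v 0 t) AE enum_rankK_in.
Qed.

Lemma handicap_bound (F : fieldType) (d n : nat) (T : finType) (S : {set T})
    (x : T -> 'rV[F]_d) (B : T -> 'M[F]_d) (line : 'I_d -> rel T)
    (beta : T -> nat) (b : T -> 'I_d -> nat) :
  injective x ->
  (forall p, p \in S -> B p \in unitmx) ->
  (forall p q i, p \in S -> q \in S -> line i p q ->
     exists s, x q = x p + s *: row i (B p)) ->
  (forall p i, p \in S ->
     n < \sum_(q in S | line i p q) (b p i + beta p - beta q))%N ->
  S != set0 ->
  ('C(d + n, d) <= \sum_(p in S) \prod_i b p i)%N.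
Proof.
move=> xI uB xline bsum S0; rewrite leqNgt; apply/negP => lt_sum.
have [g g0 [gn gb]] := exists_mpoly_coef0
  (fun p => comp_mpoly (affine_subst (x p) (B p)) : {linear _ -> _}) lt_sum.
by have := handicap_vanishing xI uB xline bsum S0 gn gb; apply/eqP.
Qed.

End Polynomials.

(** * Multijoints *)

From mathcomp Require Import finmap.
From mathcomp Require Import boolp classical_sets cardinality reals exp.

Local Open Scope classical_set_scope.
Local Open Scope ring_scope.

(** * Directions of lines and the basis at a joint *)

Lemma line_direction (F : fieldType) (d : nat) (l : set 'rV[F]_d) (p : 'rV[F]_d) :
  is_line l -> l p ->
  exists v : 'rV[F]_d, forall q, l q -> exists s, q = p + s *: v.
Proof.
move=> [a [U [dimU ->]]] [u /= uU <-]; exists (vpick U) => _ [w /= wU <-].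
have UE : U = <[vpick U]>%VS.
  apply/esym/eqP; rewrite eqEdim -memvE memv_pick dimU dim_vline.
  by rewrite vpick0 -dimv_eq0 dimU.
have /vlineP[s ws] : w - u \in <[vpick U]>%VS by rewrite -UE rpredB.
by exists s; rewrite -ws addrA -[a + u + w]addrA [u + w]addrC addrA addrK.
Qed.

Lemma normal_hyperplane (F : fieldType) (d : nat) (p w : 'rV[F]_d) : w != 0 ->
  is_hyperplane [set q | (q - p) *m w^T = 0].
Proof.
move=> w0; pose f : 'Hom('rV[F]_d, 'M[F]_1) := linfun (mulmxr w^T).
exists p, (lker f); split.
  have := limg_ker_dim f fullv; rewrite capfv dimvf /dim /= mul1n.
  suff -> : \dim (limg f) = 1%N by rewrite addn1 => /(congr1 predn).
  apply/eqP; rewrite eqn_leq; apply/andP; split.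
    by apply: leq_trans (dimvS (subvf _)) _; rewrite dimvf /dim /= muln1.
  rewrite lt0n dimv_eq0; apply: contra w0 => /eqP f0.
  apply/eqP/rowP => j; have : f (delta_mx 0 j) \in limg f by rewrite memv_img ?memvf.
  rewrite f0 memv0 lfunE /= => /eqP/matrixP/(_ 0 0).
  by rewrite -rowE !mxE.
apply/seteqP; split=> q /=.
  move=> qw; exists (q - p); last by rewrite addrC subrK.
  by rewrite /= memv_ker lfunE /= qw.
by move=> [u /= + <-]; rewrite memv_ker lfunE /= addrC addKr => /eqP.
Qed.

(** If the directions were dependent, a nonzero [w] orthogonal to all of them would define a
    hyperplane through [p] containing every [l i]. *)
Lemma joint_basis (F : fieldType) (d : nat) (l : 'I_d -> set 'rV[F]_d) (p : 'rV[F]_d) :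
  (forall i, is_line (l i)) -> (forall i, l i p) ->
  ~ (exists H : set 'rV[F]_d, is_hyperplane H /\ forall i, l i `<=` H) ->
  exists2 B : 'M[F]_d, B \in unitmx &
    forall i q, l i q -> exists s, q = p + s *: row i B.
Proof.
move=> lline lp nH.
have [v vP] := fin_all_exists (fun i => line_direction (lline i) (lp i)).
pose B := \matrix_i v i.
have BP i q : l i q -> exists s, q = p + s *: row i B by rewrite rowK; exact: vP.
exists B => //; rewrite unitmxE unitfE; apply/negP => detB.
have /det0P[w w0 wB] : \det B^T == 0 by rewrite det_tr.
apply: nH; exists [set q | (q - p) *m w^T = 0]; split; first exact: normal_hyperplane.
move=> i q /BP[s ->] /=; rewrite addrC addKr -scalemxAl -row_mul.
by rewrite -[B]trmxK -trmx_mul wB trmx0 row0 scaler0.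
Qed.

Lemma finite_multijoints (F : fieldType) (d : nat)
    (L : 'I_d -> {fset set 'rV[F]_d}) : finite_set [set p | is_multijoint L p].
Proof.
(* A multijoint is the only common point of its tuple, so [meet] reaches it; tuples without a common
   point go to [0]. *)
pose meet (f : {dffun forall i : 'I_d, L i}) : 'rV[F]_d :=
  xget 0 (\bigcap_i val (f i)).
apply: (@sub_finite_set _ _ (range meet)); last by apply: finite_image; exact: finite_finset.
move=> p [l [lL lp _]].
exists [ffun i => [` lL i]%fset] => //; rewrite /meet.
rewrite (_ : \bigcap_i _ = [set p]); last first.
  by rewrite -lp; apply: eq_bigcapr => i _; rewrite ffunE.
by apply: xget_unique => // q ->.
Qed.

Lemma card_multijoints (F : fieldType) (d : nat) (L : 'I_d -> {fset set 'rV[F]_d})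
    (J : {fset 'rV[F]_d}) :
  (forall i l, l \in L i -> is_line l) ->
  (forall p, p \in J -> is_multijoint L p) -> (0 < #|` J|)%N ->
  (#|` J| ^ d.-1 <= d`! * \prod_i #|` L i|)%N.
Proof.
move=> Lline JL J0.
(* One tuple is fixed per joint; two joints then count as collinear in direction [i] only if their
   chosen lines coincide. *)
have [l lP] := @boolp.choice J ('I_d -> set 'rV[F]_d) (fun p l =>
    [/\ forall i, l i \in L i, \bigcap_i l i = [set val p]
      & ~ exists H : set 'rV[F]_d, is_hyperplane H /\ forall i, l i `<=` H])
  (fun p => JL _ (valP p)).
have lL p i : l p i \in L i by case: (lP p).
have lp p i : l p i (val p).
  case: (lP p) => _ lpE _; suff : [set val p] (val p) by rewrite -lpE; apply.
  by [].
have [B uB BP] : exists2 B : J -> 'M[F]_d, forall p, B p \in unitmx &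
    forall p i q, l p i q -> exists s, q = val p + s *: row i (B p).
  have [p|B BP] := @boolp.choice J 'M[F]_d (fun p B => B \in unitmx /\
    forall i q, l p i q -> exists s, q = val p + s *: row i B).
    have [_ _ nH] := lP p.
    have [B ? ?] := joint_basis (fun i => Lline _ _ (lL p i)) (lp p) nH.
    by exists B.
  by exists B => p; case: (BP p).
pose key i (p : J) : L i := [` lL p i]%fset.
under eq_bigr do rewrite cardfE.
rewrite cardfE; apply: (card_multijoint_bound (key := key)) => [|S n beta b S0 hb].
  by rewrite -cardfE.
apply: (@handicap_bound F d n J S val B (fun i p q => key i p == key i q) beta b) => //.
- exact: val_inj.
- move=> p q i _ _ /eqP/(congr1 val) /= pq; apply: BP.
  by rewrite pq; exact: lp.
Qed.

Theorem theorem3p3 (R : realType) (F : fieldType) (d : nat) (hd : (2 <= d)%N)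
  (L : 'I_d -> {fset set 'rV[F]_d})
  (hL : forall (i : 'I_d) (l : set 'rV[F]_d), l \in L i -> is_line l)
  (J : set 'rV[F]_d)
  (hJ : forall p : 'rV[F]_d, J p -> is_multijoint L p) :
  finite_set J /\
  (#|` fset_set J|)%:R <=
    ((d`!)%:R * \prod_(i < d) (#|` L i|)%:R : R) `^ (1 / (d%:R - 1)).
Proof.
have finJ : finite_set J by apply: sub_finite_set (finite_multijoints L).
split=> //; have [J0|J0] := posnP #|` fset_set J|; first by rewrite J0 powR_ge0.
have JL p : p \in fset_set J -> is_multijoint L p.
  by rewrite in_fset_set // inE; exact: hJ.
have := card_multijoints hL JL J0; rewrite -(ler_nat R) natrX natrM natr_prod.
set t := #|` _| in J0 *; move=> tP.
have d1 : d%:R - 1 = d.-1%:R :> R by rewrite -subn1 natrB // ltnW.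
have d0 : d.-1%:R != 0 :> R by rewrite pnatr_eq0 -lt0n -subn1 subn_gt0.
(* With [t] written as a root of its own power, the integer bound passes through the monotone
   root. *)
have -> : t%:R = (t%:R ^+ d.-1) `^ (1 / (d%:R - 1)) :> R.
  by rewrite -powR_mulrn ?ler0n // -powRrM d1 mulrC divfK // powRr1 ?ler0n.
apply: ge0_ler_powR tP; rewrite ?nnegrE ?exprn_ge0 ?ler0n //.
  by rewrite d1 divr_ge0 ?ler0n.
by rewrite mulr_ge0 ?ler0n // prodr_ge0.
Qed.
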